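(* Let $R(S,\kappa)$ be a near-integral fusion ring. If $d_+\in\mathbb{Z}$, then $\kappa<N$. Moreover, if $\kappa\geq N$, then $d_+$ is irrational.
   Context: A fusion ring $(R,B)$ is a unital associative ring $R$, free as a $\mathbb{Z}$-module with finite basis $B=\{1_R=b_1,\ldots,b_n\}$, such that $b_ib_j=\sum_k c_{ij}^kb_k$ with $c_{ij}^k\in\mathbb{Z}_{\geq0}$, together with an involution $\ast$ of $\{1,\ldots,n\}$ such that $\sum_ja_jb_j\mapsto\sum_ja_jb_{j^\ast}$ is an antiautomorphism of $R$ and $c_{ij}^1=1$ if $i=j^\ast$ and $0$ otherwise. $\mathrm{FPdim}:R\to\mathbb{C}$ is the ring homomorphism sending each $b_i\in B$ to the maximal real eigenvalue of $[c_{ij}^k]_{j,k}$, and $\mathrm{FPdim}(R):=\sum_{b\in B}\mathrm{FPdim}(b)^2$. A fusion subring is a fusion ring $(S,C)$ with $C\subseteq B$ and $S\subseteq R$ the $\mathbb{Z}$-span of $C$. $(R,B)$ is near-integral if it has a fusion subring $(S,C)$ with $|C|+1=|B|$. Then $\rho$ denotes the unique element of $B\setminus C$, $\kappa:=c_{\rho,\rho}^\rho\in\mathbb{Z}_{\geq0}$, $N:=\mathrm{FPdim}(S)$ (a positive integer), $d_+:=\mathrm{FPdim}(\rho)$, and $R$ is denoted $R(S,\kappa)$; its fusion rules are those of $S$ together with $x\rho=\rho x=\mathrm{FPdim}(x)\rho$ for $x\in C$ and $\rho^2=\kappa\rho+\sum_{x\in C}\mathrm{FPdim}(x)x$. In particular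 $d_+$ is the positive root of $x^2-\kappa x-N=0$. *)

(* Defs.v *)
From HB Require Import structures.
From mathcomp Require Import all_boot all_order all_algebra.
From mathcomp Require Import boolp classical_sets reals.

Set Implicit Arguments.
Unset Strict Implicit.
Unset Printing Implicit Defensive.

Import Order.TTheory GRing.Theory Num.Theory.
Local Open Scope ring_scope.

Definition antiautomorphism (R : pzRingType) (f : R -> R) : Prop :=
  [/\ {morph f : x y / x + y}, f 1 = 1,
      forall x y, f (x * y) = f y * f x & bijective f].

(* Basis elements are indexed from 0, so [ord0] is the index the mathematics
   calls 1.  [fcoordK] and [fbasisK] together say that [fbasis] is a Z-basis,
   [fcoord] being the (unique) coordinate map; the structure constant c_ij^k is
   therefore [fcoord (fbasis i * fbasis j) k]. *)
Record fusionRing := FusionRing {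
  fcarrier :> pzRingType;
  fn : nat;
  fbasis : 'I_fn.+1 -> fcarrier;
  fcoord : fcarrier -> 'I_fn.+1 -> int;
  fcoordK : forall x, \sum_i fbasis i *~ fcoord x i = x;
  fbasisK : forall (a : 'I_fn.+1 -> int) i,
    fcoord (\sum_j fbasis j *~ a j) i = a i;
  fbasis0 : fbasis ord0 = 1;
  fcoord_ge0 : forall i j k, 0 <= fcoord (fbasis i * fbasis j) k;
  fdual : 'I_fn.+1 -> 'I_fn.+1;
  fdualK : involutive fdual;
  fdual_anti : antiautomorphism
    (fun x => \sum_j fbasis (fdual j) *~ fcoord x j);
  fdual_unit : forall i j,
    fcoord (fbasis i * fbasis j) ord0 = (i == fdual j)%:Z
}.

Arguments fbasis : clear implicits.
Arguments fdual : clear implicits.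

Definition frank (R : fusionRing) : nat := (fn R).+1.

Definition fconst (R : fusionRing) (i j k : 'I_(fn R).+1) : int :=
  fcoord (fbasis R i * fbasis R j) k.

(* Eigenvalues are taken in the real field [K], hence are the real ones. *)
Definition max_eigenvalue (K : realType) (n : nat) (M : 'M[K]_n) : K :=
  xget 0 [set a : K | eigenvalue M a /\ forall e, eigenvalue M e -> e <= a].

Definition FPdim_basis (K : realType) (R : fusionRing) (i : 'I_(fn R).+1) : K :=
  max_eigenvalue (\matrix_(j, k) (fconst i j k)%:~R).

(* FPdim is determined, being additive, by its values on the basis. *)
Definition FPdim (K : realType) (R : fusionRing) (x : R) : K :=
  \sum_i FPdim_basis K i *~ fcoord x i.

Definition FPdim_ring (K : realType) (R : fusionRing) : K :=
  \sum_i FPdim K (fbasis R i) ^+ 2.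

(* The subset relations are carried by the inclusion [fincl]; being a morphism
   that maps the basis C of S into the basis B of R, its image is the Z-span of
   the image of C. *)
Record fusionSubring (R : fusionRing) := FusionSubring {
  fsub :> fusionRing;
  fincl : {rmorphism fsub -> R};
  fincl_inj : injective fincl;
  fincl_basis : forall i, exists j, fincl (fbasis fsub i) = fbasis R j
}.

Record nearIntegral := NearIntegral {
  ni_ring :> fusionRing;
  ni_sub : fusionSubring ni_ring;
  ni_rank : (frank ni_sub + 1)%N = frank ni_ring;
  ni_rho : 'I_(fn ni_ring).+1;
  ni_rhoP : forall i, fincl ni_sub (fbasis ni_sub i) != fbasis ni_ring ni_rho
}.

Definition ni_kappa (R : nearIntegral) : int :=
  fconst (ni_rho R) (ni_rho R) (ni_rho R).

Definition ni_N (K : realType) (R : nearIntegral) : K :=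
  FPdim_ring K (ni_sub R).

Definition ni_d (K : realType) (R : nearIntegral) : K :=
  FPdim K (fbasis R (ni_rho R)).

(* Main.v *)
Require Import Defs.
From HB Require Import structures.
From mathcomp Require Import all_boot all_order all_algebra.
From mathcomp Require Import boolp classical_sets reals.
From mathcomp Require Import ring lra zify.
Import Order.TTheory GRing.Theory Num.Theory.
Local Open Scope ring_scope.

(** A nonnegative matrix with a positive eigenvector has the corresponding
    eigenvalue as its maximal real eigenvalue.  For [x] in [C] the product
    [x rho] is a multiple [m x] of [rho], and [m] is a positive character of
    [S], hence equals FPdim on [S]; likewise [(m, d)] is a positive eigenvector
    of multiplication by [rho], [d] being the positive root of
    [d^2 = kappa d + N] with [N = \sum_x (m x)^2].  A rational [d] is then an
    integer, and [N = d (d - kappa)] forces [kappa < d <= N]. *)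

(** * Perron-Frobenius bound for nonnegative matrices *)

Section MaxEigenvalue.
Context {K : realType} {n : nat}.
Implicit Type M : 'M[K]_n.

(** [eigenvalue] refers to row vectors, so a column eigenvector has to pass through the
    transpose. *)
Lemma eigenvalue_trmx M a : eigenvalue M^T a = eigenvalue M a.
Proof.
by rewrite !eigenvalue_root_char /char_poly -det_tr; congr (root (\det _) _);
  apply/matrixP=> i j; rewrite !mxE eq_sym.
Qed.

Lemma max_eigenvalueP M a : eigenvalue M a ->
  (forall e, eigenvalue M e -> e <= a) -> max_eigenvalue M = a.
Proof.
move=> Ma amax; rewrite /max_eigenvalue; apply: xget_unique => // b [Mb bmax].
by apply/le_anti; rewrite amax // bmax.
Qed.

(** If [v] is a row eigenvector for [e], the triangle inequality gives [e * |v| <= |v| M] entrywise.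
    Pairing with [u] turns the right side into [a] times the pairing of [|v|] with [u], which is
    positive and cancels. *)
Lemma max_eigenvalue_pos_vector M (u : 'I_n -> K) a :
  (0 < n)%N -> (forall j k, 0 <= M j k) -> (forall k, 0 < u k) ->
  (forall j, \sum_k M j k * u k = a * u j) -> max_eigenvalue M = a.
Proof.
move=> n_gt0 M_ge0 u_gt0 Mu; apply: max_eigenvalueP.
  rewrite -eigenvalue_trmx; apply/eigenvalueP; exists (\row_k u k).
    apply/rowP=> j; rewrite !mxE -Mu; apply: eq_bigr => k _.
    by rewrite !mxE mulrC.
  apply/eqP=> /rowP/(_ (Ordinal n_gt0)); rewrite !mxE => u0.
  by have := u_gt0 (Ordinal n_gt0); rewrite u0 ltxx.
move=> e /eigenvalueP[v vM v_neq0].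
have v_u_gt0 : 0 < \sum_k `|v 0 k| * u k.
  rewrite lt_neqAle sumr_ge0 ?andbT => [|k _]; last first.
    by rewrite mulr_ge0 // ltW.
  apply: contraNneq v_neq0 => /esym/eqP.
  rewrite psumr_eq0 => [/allP vu0|k _]; last by rewrite mulr_ge0 // ltW.
  apply/eqP/rowP=> k; rewrite mxE; apply/eqP.
  have := vu0 k (mem_index_enum k).
  by rewrite /= mulf_eq0 (gt_eqF (u_gt0 k)) orbF normr_eq0.
rewrite -(ler_pM2r v_u_gt0) !mulr_sumr.
under [leRHS]eq_bigr => j _ do rewrite mulrCA -Mu mulr_sumr.
rewrite exchange_big /=; apply: ler_sum => k _.
under eq_bigr => j _ do rewrite mulrA.
rewrite -mulr_suml mulrA ler_wpM2r ?(ltW (u_gt0 k)) //.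
apply: le_trans (_ : `|e * v 0 k| <= _).
  by rewrite normrM ler_wpM2r // ler_norm.
move/rowP/(_ k): vM; rewrite !mxE => <-.
apply: le_trans (ler_norm_sum _ _ _) _; apply: ler_sum => j _.
by rewrite normrM (ger0_norm (M_ge0 j k)).
Qed.

End MaxEigenvalue.

(** * Coordinates, duality and the trace [fcoord _ ord0] in a fusion ring *)

Section FusionRingTheory.
Context {R : fusionRing}.
Implicit Types (x y : R) (i j k : 'I_(fn R).+1).
Local Notation b := (fbasis R).

Definition fcoord_at k x : int := fcoord x k.

Lemma fcoord_at_is_zmod_morphism k : zmod_morphism (fcoord_at k).
Proof.
move=> x y; rewrite /fcoord_at -{1}(fcoordK x) -{1}(fcoordK y) -sumrB.
by under eq_bigr => i _ do rewrite -mulrzBr; rewrite fbasisK.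
Qed.

HB.instance Definition _ k :=
  GRing.isZmodMorphism.Build R int (fcoord_at k) (fcoord_at_is_zmod_morphism k).

Lemma fcoordMz x n k : fcoord (x *~ n) k = fcoord x k * n.
Proof. by rewrite -[LHS]/(fcoord_at k _) raddfMz -mulrzr intz. Qed.

Lemma fcoord_sum (I : Type) (r : seq I) (F : I -> R) (a : I -> int) k :
  fcoord (\sum_(i <- r) F i *~ a i) k = \sum_(i <- r) fcoord (F i) k * a i.
Proof.
rewrite -[LHS]/(fcoord_at k _) raddf_sum; apply: eq_bigr => i _.
exact: fcoordMz.
Qed.

Lemma fcoord_basis i k : fcoord (b i) k = (i == k)%:Z.
Proof.
have -> : b i = \sum_j b j *~ (i == j)%:Z.
  rewrite (bigD1 i) //= eqxx big1 ?addr0 // => j.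
  by rewrite eq_sym => /negPf->.
by rewrite fbasisK.
Qed.

Lemma fbasis_inj : injective b.
Proof.
move=> i j ij; have := fcoord_basis i j; rewrite ij fcoord_basis eqxx.
by case: eqP.
Qed.

Lemma fcoord_mull x y k :
  fcoord (x * y) k = \sum_i fcoord (b i * y) k * fcoord x i.
Proof.
rewrite -fcoord_sum -{1}(fcoordK x) mulr_suml.
by under eq_bigr => i _ do rewrite mulrzAl.
Qed.

Lemma fcoord_mulr x y k :
  fcoord (x * y) k = \sum_j fcoord (x * b j) k * fcoord y j.
Proof.
rewrite -fcoord_sum -{1}(fcoordK y) mulr_sumr.
by under eq_bigr => i _ do rewrite mulrzAr.
Qed.

Lemma fdual_eqC i j : (i == fdual R j) = (j == fdual R i).
Proof. by rewrite -(can_eq (@fdualK R)) fdualK eq_sym. Qed.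

(** By bilinearity it suffices to treat basis elements, where the condition [i == fdual R j] is
    symmetric. *)
Lemma fcoord0_mulC x y : fcoord (x * y) ord0 = fcoord (y * x) ord0.
Proof.
rewrite fcoord_mull [RHS]fcoord_mulr; apply: eq_bigr => i _; congr (_ * _).
rewrite fcoord_mulr [RHS]fcoord_mull; apply: eq_bigr => j _; congr (_ * _).
by rewrite !fdual_unit fdual_eqC.
Qed.

(** The basis and its dual are dual for the trace form; with cyclicity this gives Frobenius
    reciprocity. *)
Lemma fcoord_dual x k : fcoord x k = fcoord (x * b (fdual R k)) ord0.
Proof.
rewrite fcoord_mull (bigD1 k) //= fdual_unit fdualK eqxx mul1r.
rewrite big1 ?addr0 // => i ik.
by rewrite fdual_unit fdualK (negPf ik) mul0r.
Qed.

Lemma fdual0 : fdual R ord0 = ord0.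
Proof.
have := fdual_unit (ord0 : 'I_(fn R).+1) ord0.
by rewrite !fbasis0 mulr1 -fbasis0 fcoord_basis eqxx; case: eqP.
Qed.

Definition fstar x : R := \sum_j b (fdual R j) *~ fcoord x j.

Lemma fstar_basis i : fstar (b i) = b (fdual R i).
Proof.
rewrite /fstar (bigD1 i) //= fcoord_basis eqxx big1 ?addr0 // => j ji.
by rewrite fcoord_basis eq_sym (negPf ji).
Qed.

Lemma fstarM x y : fstar (x * y) = fstar y * fstar x.
Proof. by case: (fdual_anti R) => _ _ + _; apply. Qed.

Lemma fcoord0_star x : fcoord (fstar x) ord0 = fcoord x ord0.
Proof.
rewrite fcoord_sum (bigD1 ord0) //= fcoord_basis fdual0 eqxx mul1r.
rewrite big1 ?addr0 // => i i0.
by rewrite fcoord_basis -fdual0 (can_eq (@fdualK R)) (negPf i0) mul0r.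
Qed.

Lemma FPdim_fbasis (K : realType) i : FPdim K (b i) = FPdim_basis K i.
Proof.
rewrite /FPdim (bigD1 i) //= fcoord_basis eqxx big1 ?addr0 // => j ji.
by rewrite fcoord_basis eq_sym (negPf ji).
Qed.

Lemma FPdim_basis_pos_vector (K : realType) i (u : 'I_(fn R).+1 -> K) a :
  (forall k, 0 < u k) ->
  (forall j, \sum_k (fconst i j k)%:~R * u k = a * u j) ->
  FPdim_basis K i = a.
Proof.
move=> u_gt0 iu; apply: (max_eigenvalue_pos_vector _ u) => // [j k|j].
  by rewrite mxE ler0z fcoord_ge0.
by rewrite -iu; apply: eq_bigr => k _; rewrite mxE.
Qed.

End FusionRingTheory.

(** * The basis of [R] as the basis of [S] together with [rho] *)

Section NearIntegralTheory.
Context (R : nearIntegral).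
Local Notation S := (ni_sub R).
Local Notation bR := (fbasis R).
Local Notation bS := (fbasis S).
Local Notation rho := (ni_rho R).
Implicit Types i j k : 'I_(fn S).+1.

Lemma ni_idx_subproof i : exists j : 'I_(fn R).+1, fincl S (bS i) == bR j.
Proof. by have [j /eqP] := fincl_basis i; exists j. Qed.

Definition ni_idx i : 'I_(fn R).+1 := xchoose (ni_idx_subproof i).

Lemma ni_idxE i : fincl S (bS i) = bR (ni_idx i).
Proof. exact/eqP/(xchooseP (ni_idx_subproof i)). Qed.

Lemma ni_idx_inj : injective ni_idx.
Proof.
move=> i j ij; apply: fbasis_inj; apply: (@fincl_inj _ S).
by rewrite !ni_idxE ij.
Qed.

Lemma ni_idx_neq_rho i : ni_idx i != rho.
Proof. by apply: contra_neq (ni_rhoP i) => <-; rewrite ni_idxE. Qed.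

Variant ni_idx_spec : 'I_(fn R).+1 -> Prop :=
  | NiIdx i : ni_idx_spec (ni_idx i)
  | NiRho : ni_idx_spec rho.

(** The image avoids [rho], and by [ni_rank] both sides have the same cardinality. *)
Lemma ni_idx_cover : ni_idx @: 'I_(fn S).+1 = [set~ rho]%SET.
Proof.
apply/eqP; rewrite eqEcard; apply/andP; split.
  by apply/fintype.subsetP=> _ /imsetP[i _ ->]; rewrite !inE ni_idx_neq_rho.
rewrite card_imset; last exact: ni_idx_inj.
rewrite card_ord cardsC1 card_ord.
by have := ni_rank R; rewrite /frank; lia.
Qed.

Lemma ni_idxP l : ni_idx_spec l.
Proof.
have [->|l_rho] := eqVneq l rho; first exact: NiRho.
have: l \in ni_idx @: 'I_(fn S).+1 by rewrite ni_idx_cover !inE.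
by case/imsetP => i _ ->; apply: NiIdx.
Qed.

Lemma ni_big (V : nmodType) (F : 'I_(fn R).+1 -> V) :
  \sum_l F l = F rho + \sum_i F (ni_idx i).
Proof.
rewrite (bigD1 rho) //=; congr (_ + _).
transitivity (\sum_(l in ni_idx @: 'I_(fn S).+1) F l).
  by apply: eq_bigl => l; rewrite ni_idx_cover !inE.
by rewrite big_imset //= => i j _ _; apply: ni_idx_inj.
Qed.

Lemma fincl_coord (x : S) : fincl S x = \sum_i bR (ni_idx i) *~ fcoord x i.
Proof.
rewrite -{1}(fcoordK x) raddf_sum; apply: eq_bigr => i _.
by rewrite -ni_idxE raddfMz.
Qed.

Lemma fcoord_incl (x : S) k : fcoord (fincl S x) (ni_idx k) = fcoord x k.
Proof.
rewrite fincl_coord fcoord_sum (bigD1 k) //= fcoord_basis eqxx mul1r.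
rewrite big1 ?addr0 // => i ik.
by rewrite fcoord_basis (inj_eq ni_idx_inj) (negPf ik) mul0r.
Qed.

Lemma fcoord_incl_rho (x : S) : fcoord (fincl S x) rho = 0.
Proof.
rewrite fincl_coord fcoord_sum big1 // => i _.
by rewrite fcoord_basis (negPf (ni_idx_neq_rho i)) mul0r.
Qed.

Lemma ni_idx0 : ni_idx ord0 = ord0.
Proof. by apply: fbasis_inj; rewrite -ni_idxE !fbasis0 rmorph1. Qed.

(** The inclusion preserves the coefficient of 1, which detects dual pairs. *)
Lemma ni_idx_dual i : fdual R (ni_idx i) = ni_idx (fdual S i).
Proof.
have := fdual_unit (ni_idx (fdual S i)) (ni_idx i).
rewrite -!ni_idxE -rmorphM -ni_idx0 fcoord_incl fdual_unit eqxx.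
by case: eqP.
Qed.

(** Duality preserves the basis of [S], hence also its one-element complement. *)
Lemma rho_dual : fdual R rho = rho.
Proof.
move ri: (fdual R rho) => l; case: (ni_idxP l) ri => // i ri.
have /eqP[] := ni_idx_neq_rho (fdual S i).
by rewrite -ni_idx_dual -ri fdualK.
Qed.

(** * Fusion rules involving [rho] *)

Definition ni_mult i : int := fconst (ni_idx i) rho rho.
Local Notation m := ni_mult.

(** For x, y in C, the coefficient of y in x rho is the trace of y* x rho, that is, the coefficient
    of rho in y* x, which vanishes because y* x lies in S. *)
Lemma idx_mul_rho i : bR (ni_idx i) * bR rho = bR rho *~ m i.
Proof.
rewrite -[LHS]fcoordK ni_big big1 ?addr0 // => k _.
rewrite fcoord_dual fcoord0_mulC mulrA ni_idx_dual -!ni_idxE -rmorphM.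
by rewrite -rho_dual -fcoord_dual fcoord_incl_rho mulr0z.
Qed.

Lemma ni_multE i : m i = fcoord (bR (ni_idx i) * (bR rho * bR rho)) ord0.
Proof. by rewrite mulrA -{2}rho_dual -fcoord_dual. Qed.

(** The star preserves the trace and sends x rho^2 to rho^2 x*. *)
Lemma ni_mult_dual i : m (fdual S i) = m i.
Proof.
rewrite !ni_multE -[RHS]fcoord0_star !fstarM !fstar_basis rho_dual.
by rewrite ni_idx_dual fcoord0_mulC.
Qed.

Lemma rho_mul_idx i : bR rho * bR (ni_idx i) = bR rho *~ m i.
Proof.
rewrite -ni_mult_dual -[LHS]fcoordK ni_big big1 ?addr0 => [|k _].
  congr (_ *~ _); rewrite fcoord_dual rho_dual ni_multE -ni_idx_dual.
  rewrite -[RHS]fcoord0_star !fstarM !fstar_basis rho_dual fdualK.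
  by rewrite fcoord0_mulC mulrA.
rewrite fcoord_dual ni_idx_dual -mulrA -!ni_idxE -rmorphM fcoord0_mulC.
by rewrite -rho_dual -fcoord_dual fcoord_incl_rho mulr0z.
Qed.

Lemma rho_mul_rho k : fcoord (bR rho * bR rho) (ni_idx k) = m k.
Proof. by rewrite fcoord_dual fcoord0_mulC ni_idx_dual -ni_multE ni_mult_dual. Qed.

(** Both sides are the coefficient of rho in x y rho; thus [m] is a character of S. *)
Lemma ni_multM i j : m i * m j = \sum_k fconst i j k * m k.
Proof.
transitivity (fcoord (bR (ni_idx i) * bR (ni_idx j) * bR rho) rho).
  rewrite -mulrA idx_mul_rho mulrzAr idx_mul_rho -mulrzA.
  by rewrite fcoordMz fcoord_basis eqxx mul1r.
rewrite -!ni_idxE -rmorphM fincl_coord mulr_suml.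
under eq_bigr => k _ do rewrite mulrzAl.
by rewrite fcoord_sum; apply: eq_bigr => k _; rewrite mulrC.
Qed.

Lemma ni_mult_ge0 i : 0 <= m i.
Proof. exact: fcoord_ge0. Qed.

Lemma ni_mult0 : m ord0 = 1.
Proof. by rewrite /m /fconst ni_idx0 fbasis0 mul1r fcoord_basis eqxx. Qed.

(** The product of the values of [m] at x and x* is a sum of nonnegative terms, and the term at 1
    equals 1. *)
Lemma ni_mult_gt0 i : 0 < m i.
Proof.
rewrite lt_neqAle ni_mult_ge0 andbT eq_sym; apply/eqP => mi0.
have := ni_multM i (fdual S i); rewrite mi0 mul0r (bigD1 ord0) //=.
rewrite ni_mult0 /fconst fdual_unit fdualK eqxx => /eqP.
rewrite eq_sym paddr_eq0 //; apply: sumr_ge0 => k _.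
by rewrite mulr_ge0 ?fcoord_ge0 ?ni_mult_ge0.
Qed.

(** * Frobenius-Perron dimensions of the elements of C and of [rho] *)

Context (K : realType).

(** Multiplicativity of [m] says that [m] itself is a positive eigenvector of multiplication by
    x. *)
Lemma FPdim_sub i : FPdim_basis K i = (m i)%:~R.
Proof.
apply: (FPdim_basis_pos_vector _ _ (fun k => (m k)%:~R)) => [k|j].
  by rewrite ltr0z ni_mult_gt0.
by rewrite -intrM ni_multM rmorph_sum; apply: eq_bigr => k _; rewrite -intrM.
Qed.

Definition ni_normZ : int := \sum_i m i ^+ 2.

Lemma ni_NE : ni_N K R = ni_normZ%:~R.
Proof.
rewrite /ni_N /FPdim_ring rmorph_sum; apply: eq_bigr => i _.
by rewrite FPdim_fbasis FPdim_sub rmorphXn.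
Qed.

Lemma ni_normZ_gt0 : 0 < ni_normZ.
Proof.
rewrite /ni_normZ (bigD1 ord0) //= ni_mult0 ltr_wpDr //.
by apply: sumr_ge0 => i _; apply: sqr_ge0.
Qed.

Lemma ni_kappa_ge0 : 0 <= ni_kappa R.
Proof. exact: fcoord_ge0. Qed.

Lemma ni_d_unique (d : K) : 0 < d ->
  d ^+ 2 = (ni_kappa R)%:~R * d + ni_normZ%:~R -> ni_d K R = d.
Proof.
move=> d_gt0 d2; rewrite /ni_d FPdim_fbasis.
(* The candidate eigenvector is [m] on C and [d] at [rho]; [pick] inverts [ni_idx]. *)
pose u l : K :=
  if [pick i | ni_idx i == l] is Some i then (m i)%:~R else d.
have u_idx i : u (ni_idx i) = (m i)%:~R.
  rewrite /u; case: pickP => [j /eqP/ni_idx_inj->//|/(_ i)].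
  by rewrite eqxx.
have u_rho : u rho = d.
  by rewrite /u; case: pickP => // j; rewrite (negPf (ni_idx_neq_rho j)).
apply: (FPdim_basis_pos_vector _ _ u) => [l|l].
  by case: (ni_idxP l) => [i|]; rewrite ?u_idx ?u_rho // ltr0z ni_mult_gt0.
rewrite ni_big u_rho; under eq_bigr => k _ do rewrite u_idx.
(* The row of x in C reads off rho x = m(x) rho; the row of [rho] is the quadratic equation for
   [d]. *)
case: (ni_idxP l) => [i|]; rewrite ?u_idx ?u_rho /fconst.
  have coordE l' : fcoord (bR rho * bR (ni_idx i)) l' = (rho == l')%:Z * m i.
    by rewrite rho_mul_idx fcoordMz fcoord_basis.
  rewrite coordE eqxx mul1r big1 ?addr0 ?[d * _]mulrC // => k _.
  by rewrite coordE eq_sym (negPf (ni_idx_neq_rho k)) mul0r mul0r.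
rewrite -[d * d]expr2 d2; congr (_ + _); rewrite rmorph_sum.
by apply: eq_bigr => k _; rewrite rho_mul_rho rmorphXn.
Qed.

(** The quadratic formula supplies a positive root, which [ni_d_unique] identifies with
    [ni_d K R]. *)
Lemma ni_d_gt0_root : 0 < ni_d K R /\
  ni_d K R ^+ 2 = (ni_kappa R)%:~R * ni_d K R + ni_normZ%:~R.
Proof.
set a : K := (ni_kappa R)%:~R; set c : K := ni_normZ%:~R.
have a_ge0 : 0 <= a by rewrite ler0z ni_kappa_ge0.
have c_gt0 : 0 < c by rewrite ltr0z ni_normZ_gt0.
pose s := Num.sqrt (a ^+ 2 + 4 * c).
have s2 : s ^+ 2 = a ^+ 2 + 4 * c by rewrite sqr_sqrtr //; nra.
have s_gt0 : 0 < s by rewrite sqrtr_gt0; nra.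
have d_gt0 : 0 < (a + s) / 2 by lra.
have d2 : ((a + s) / 2) ^+ 2 = a * ((a + s) / 2) + c by nra.
by rewrite (ni_d_unique _ d_gt0 d2).
Qed.

End NearIntegralTheory.

(** * Integer and rational roots of the quadratic *)

Lemma lt_int_quadratic_root (d a c : int) :
  0 <= a -> 0 < c -> 0 < d -> d ^+ 2 = a * d + c -> a < c.
Proof.
rewrite expr2 => a_ge0 c_gt0 d_gt0 d2; have : a < d by nia.
(* Integrality gives [d - a >= 1], so [c = d * (d - a) >= d > a]. *)
nia.
Qed.

(** Rational root theorem: after clearing denominators, [denq q] divides the square of [numq q], to
    which it is coprime. *)
Lemma rat_quadratic_root_int (q : rat) (a c : int) :
  q ^+ 2 = a%:~R * q + c%:~R -> q \is a Num.int.
Proof.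
move=> q2; have e : numq q ^+ 2 = (a * numq q + c * denq q) * denq q.
  apply: (@intr_inj rat); rewrite rmorphXn !(rmorphM, rmorphD) /= numqE.
  by rewrite exprMn q2; ring.
have: (denq q %| numq q ^+ 2)%Z by rewrite e dvdz_mull.
rewrite expr2 Gauss_dvdzr => [/Qint_dvdz|]; first by rewrite divq_num_den.
by rewrite coprimez_sym; apply: coprime_num_den.
Qed.

Theorem lemma3p2 (K : realType) (R : nearIntegral) :
  (ni_d K R \is a Num.int -> (ni_kappa R)%:~R < ni_N K R) /\
  (ni_N K R <= (ni_kappa R)%:~R -> irrational (ni_d K R)).
Proof.
have [d_gt0 d2] := ni_d_gt0_root R K.
have int_case : ni_d K R \is a Num.int -> (ni_kappa R)%:~R < ni_N K R.
  move=> /intrP[z dz]; rewrite ni_NE ltr_int.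
  move: d_gt0 d2; rewrite dz ltr0z -rmorphXn -intrM -intrD => z_gt0 /intr_inj z2.
  exact: lt_int_quadratic_root (ni_kappa_ge0 R) (ni_normZ_gt0 R) z_gt0 z2.
split=> // N_le [q _ dq]; move: d2; rewrite -dq.
(* With its integer coefficients seen as images of rationals, the equation descends to [q] because
   [ratr] is injective. *)
rewrite -(ratr_int K) -(ratr_int K (ni_normZ R)) -rmorphXn -rmorphM -rmorphD.
move=> /fmorph_inj/rat_quadratic_root_int/intrP[z qz].
have /int_case : ni_d K R \is a Num.int by rewrite -dq qz ratr_int.
by rewrite ltNge N_le.
Qed.
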